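(* Let $(\nu_d,\nu^\Box_d)_{d\in\mathbb N}$ be a sequence of pairs of Borel probability measures on $\mathbb R$ such that each $\nu_d$ has finite moments of all orders, each $\nu^\Box_d$ is compactly supported, $\lim_{d\to\infty}|m_k(\nu_d)-m_k(\nu^\Box_d)|=0$ for every $k\in\mathbb N$, and there is $M'>0$ with $\operatorname{supp}\nu^\Box_d\subset[-M',M']$ for all $d$. Then for every $\gamma>0$ and $M>0$, \[\lim_{d\to\infty}\sup_{\mu\in\mathcal B_M}\big|H_\gamma(\nu_d,\mu)-H_\gamma(\nu^\Box_d,\mu)\big|=0.\]
   Context: $m_k(\mu)=\int x^k\mu(dx)$. $\mathcal B_M$ is the set of Borel probability measures on $\mathbb R$ with support in $[-M,M]$. $P_\gamma(x)=\frac{\gamma}{\pi(x^2+\gamma^2)}$, $(P_\gamma*\nu)(x)=\int P_\gamma(x-t)\nu(dt)$, $G_\mu(z)=\int\frac{\mu(dt)}{z-t}$. For compactly supported $\mu$ and $\nu$ with finite second moment, $H_\gamma(\nu,\mu)=\int\ell_\gamma(x,\mu)(P_\gamma*\nu)(x)dx$ with $\ell_\gamma(x,\mu)=-\log[-\frac1\pi\operatorname{Im}G_\mu(x+i\gamma)]$. *)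

(* Defs.v *)
From HB Require Import structures.
From mathcomp Require Import all_boot all_order all_algebra.
From mathcomp Require Import all_classical all_reals all_analysis.
From mathcomp Require Import complex.
Set Implicit Arguments. Unset Strict Implicit. Unset Printing Implicit Defensive.
Import Order.TTheory GRing.Theory Num.Theory.
Import numFieldNormedType.Exports.
Local Open Scope classical_set_scope.
Local Open Scope ring_scope.

Section Defs.
Variable R : realType.

(* Borel probability measures on R (sigma-algebra generated by intervals). *)
Notation probR := (probability R R).

(* k-th moment  m_k(mu) = \int x^k mu(dx)  (real-valued; meaningful when integrable) *)
Definition moment (mu : probR) (k : nat) : R :=
  fine (\int[mu]_x (x ^+ k)%:E)%E.

Definition finite_moments (mu : probR) : Prop :=
  forall k : nat, mu.-integrable setT (fun x : R => (x ^+ k)%:E).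

Definition msupport (mu : probR) : set R :=
  [set x | forall r : R, 0 < r -> (0 < mu (ball x r))%E].

Definition compactly_supported (mu : probR) : Prop := compact (msupport mu).

Definition BM (M : R) : set probR :=
  [set mu | msupport mu `<=` `[- M, M]].

Definition Poisson (g x : R) : R := g / (pi * (x ^+ 2 + g ^+ 2)).

Definition Pconv (g : R) (nu : probR) (x : R) : R :=
  fine (\int[nu]_t (Poisson g (x - t))%:E)%E.

(* Imaginary part of the Cauchy-Stieltjes transform G_mu(z) = \int mu(dt)/(z - t),
   computed as \int Im (1/(z - t)) mu(dt) (Im commutes with the integral). *)
Definition ImG (mu : probR) (z : R[i]) : R :=
  fine (\int[mu]_t (@complex.Im R ((z - t%:C)^-1)%C)%:E)%E.

Definition ell (g : R) (x : R) (mu : probR) : R :=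
  - ln (- pi^-1 * ImG mu (x +i* g)%C).

Definition Hg (g : R) (nu mu : probR) : R :=
  fine (\int[lebesgue_measure]_x (ell g x mu * Pconv g nu x)%:E)%E.

End Defs.

(* Main.v *)
(** Writing P for the Poisson kernel of parameter g, [ell g x mu] is - ln (P * mu)(x), so
    by Fubini H(nu, mu) is the integral against nu of phi_mu(t) := \int ell(x, mu) P(x - t) dx.
    For mu in B_M, ell grows at most like the square root of 1 + |x|, uniformly in mu, and
    Harnack's inequality P(x - t) <= (1 + h + h^2) P(x - s), h = |t - s| / g, then makes the
    phi_mu uniformly Lipschitz on compact sets and uniformly of quadratic growth.

    For such a family, Bernstein polynomials on [-K, K], K = M' + 1, have an error bounded
    on the whole line by eps + D (t / K)^(2m), with m as large as one wishes.  The 2m-th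
    moment of nu_d is eventually at most M'^(2m) + o(1) and M' < K, so the error integrates
    to something small; the polynomials themselves are controlled by the convergence of
    finitely many moments, uniformly because their values at the nodes are bounded. *)
Require Import Defs.
From HB Require Import structures.
From mathcomp Require Import all_boot all_order all_algebra.
From mathcomp Require Import all_classical all_reals all_analysis.
From mathcomp Require Import complex.
From mathcomp Require Import measurable_realfun ring lra.
Import Order.TTheory GRing.Theory Num.Theory.
Import numFieldNormedType.Exports.
Local Open Scope classical_set_scope.
Local Open Scope ring_scope.

(** * Bernstein approximation *)

Section BinomialMean.
Context {R : realFieldType}.
Implicit Types (x y C : R) (f : nat -> R).

(* The mean of [f] under the binomial distribution with parameters [n] and [x],
   i.e. \sum_(k <= n) 'C(n, k) x^k (1 - x)^(n - k) f k. *)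
Fixpoint binomial_mean x (n : nat) f : R :=
  if n is m.+1 then
    x * binomial_mean x m (fun k => f k.+1) + (1 - x) * binomial_mean x m f
  else f 0%N.

Lemma binomial_mean_cst x n C : binomial_mean x n (fun=> C) = C.
Proof. by elim: n => //= n ->; ring. Qed.

Lemma binomial_meanB x n f h :
  binomial_mean x n (fun k => f k - h k) = binomial_mean x n f - binomial_mean x n h.
Proof. by elim: n f h => //= n IH f h; rewrite !IH; ring. Qed.

Lemma binomial_mean_affine x n f a b :
  binomial_mean x n (fun k => a + b * f k) = a + b * binomial_mean x n f.
Proof. by elim: n f => //= n IH f; rewrite !IH; ring. Qed.

(** For [x] in [0, 1] the two weights [x] and [1 - x] are nonnegative, so the mean is monotone and
    the triangle inequality loses nothing on them. *)
Lemma le_normr_binomial_mean x n f h : 0 <= x <= 1 ->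
  (forall k, (k <= n)%N -> `|f k| <= h k) ->
  `|binomial_mean x n f| <= binomial_mean x n h.
Proof.
move=> /andP[x0 x1]; elim: n f h => [|n IH] f h fh /=; first exact: fh.
rewrite (le_trans (ler_normD _ _))// !normrM (ger0_norm x0).
rewrite (@ger0_norm _ (1 - x)) ?subr_ge0//.
rewrite lerD// ler_wpM2l ?subr_ge0//; apply: IH => k kn; apply: fh => //.
exact: leqW.
Qed.

(** Outside [0, 1] the binomial weights change sign; their absolute values sum to (|x| + |1 - x|)^n
    by the binomial theorem, which here appears one factor per induction step. *)
Lemma normr_binomial_mean_le x n f C :
  (forall k, (k <= n)%N -> `|f k| <= C) ->
  `|binomial_mean x n f| <= C * (`|x| + `|1 - x|) ^+ n.
Proof.
elim: n f => [|n IH] f fC /=; first by rewrite expr0 mulr1 fC.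
rewrite (le_trans (ler_normD _ _))// !normrM exprS mulrCA mulrDl lerD//.
- by rewrite ler_wpM2l//; apply: IH => k kn; exact: fC.
- by rewrite ler_wpM2l//; apply: IH => k kn; apply: fC; exact: leqW.
Qed.

Lemma eq_binomial_mean x n f h : f =1 h -> binomial_mean x n f = binomial_mean x n h.
Proof.
elim: n f h => /= [|n IH] f h fh; first exact: fh.
by rewrite (IH _ _ fh) (IH _ (fun k => h k.+1))// => k; exact: fh.
Qed.

(** Variance plus squared bias. The centre [y] is left free because the shift from [k] to [k.+1] in
    the recursion turns it into [y - 1]. *)
Lemma binomial_mean_sqr x n y :
  binomial_mean x n (fun k => (k%:R - y) ^+ 2)
  = n%:R * x * (1 - x) + (n%:R * x - y) ^+ 2.
Proof.
elim: n y => /= [|n IH] y; first by ring.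
rewrite (@eq_binomial_mean x n _ (fun k => (k%:R - (y - 1)) ^+ 2)); last first.
  by move=> k; rewrite -natr1; ring.
by rewrite !IH -natr1; ring.
Qed.
End BinomialMean.

Section Bernstein.
Context {R : realFieldType}.
Implicit Types (K L A C d t : R) (f : R -> R).

Definition bernstein_node K (n k : nat) : R := K * (2 * k%:R / n%:R - 1).

(* The [n]-th Bernstein approximant of [f] transported from [0, 1] to [-K, K]. *)
Definition bernstein K n f t : R :=
  binomial_mean ((t + K) / (2 * K)) n (fun k => f (bernstein_node K n k)).

Lemma bernstein_node_le K n k : 0 < K -> (0 < n)%N -> (k <= n)%N ->
  `|bernstein_node K n k| <= K.
Proof.
move=> K0 n0 kn; have n0' : (0 : R) < n%:R by rewrite ltr0n.
rewrite /bernstein_node -mulrA; set u : R := k%:R / n%:R.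
have u0 : 0 <= u by exact: divr_ge0.
have u1 : u <= 1 by rewrite ler_pdivrMr// mul1r ler_nat.
by rewrite ler_norml; apply/andP; split; nra.
Qed.

(** Chebyshev's argument without probabilities: the distance |u| from [t] to a node satisfies |u| <=
    d + u^2 / d, and the binomial mean of u^2 is a variance, at most K^2 / n. *)
Lemma bernstein_lipschitz_approx K L d n f t : 0 < K -> 0 <= L -> 0 < d -> (0 < n)%N ->
  (forall s t, `|s| <= K -> `|t| <= K -> `|f t - f s| <= L * `|t - s|) ->
  `|t| <= K ->
  `|f t - bernstein K n f t| <= L * (d + K ^+ 2 / (n%:R * d)).
Proof.
move=> K0 L0 d0 n0 Lf tK; have n0' : (0 : R) < n%:R by rewrite ltr0n.
set x := (t + K) / (2 * K).
have tE : t = K * (2 * x - 1) by rewrite /x; field; rewrite gt_eqF.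
have x01 : 0 <= x <= 1.
  move: tK; rewrite ler_norml => /andP[tK1 tK2].
  rewrite /x divr_ge0 ?mulr_ge0//=; [|lra|lra].
  by rewrite ler_pdivrMr ?mulr_gt0//; lra.
rewrite /bernstein -/x -{1}(binomial_mean_cst x n (f t)) -binomial_meanB.
(* This makes c (k - n x)^2 equal to L u^2 / d, since u = (2 K / n) (n x - k). *)
pose c := L * (4 * K ^+ 2 / (n%:R ^+ 2 * d)).
apply: (@le_trans _ _
  (binomial_mean x n (fun k => L * d + c * (k%:R - n%:R * x) ^+ 2))).
  apply: le_normr_binomial_mean => // k kn.
  apply: le_trans (Lf _ _ (bernstein_node_le _ _ _ K0 n0 kn) tK) _.
  set u := t - _.
  have uE : u = 2 * K / n%:R * (n%:R * x - k%:R).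
    by rewrite /u /bernstein_node {1}tE; field; rewrite gt_eqF.
  have -> : L * d + c * (k%:R - n%:R * x) ^+ 2 = L * (d + u ^+ 2 / d).
    by rewrite uE /c; field; rewrite !gt_eqF.
  rewrite ler_wpM2l// -[u ^+ 2]real_normK ?num_real//.
  have [ud|du] := leP `|u| d; first by rewrite ler_wpDr// divr_ge0 ?exprn_ge0// ltW.
  by rewrite ler_wpDl ?(ltW d0)// ler_pdivlMr// expr2 ler_wpM2l// ltW.
rewrite binomial_mean_affine binomial_mean_sqr subrr expr0n/= addr0.
(* The factor 4 x (1 - x) is isolated because it is at most 1: the difference is (2 x - 1)^2. *)
have -> : L * d + c * (n%:R * x * (1 - x))
    = L * (d + (4 * (x * (1 - x))) * (K ^+ 2 / (n%:R * d))).
  by rewrite /c; field; rewrite !gt_eqF.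
rewrite ler_wpM2l// lerD2l ler_piMl//; last first.
  by rewrite -subr_ge0 (_ : _ - _ = (2 * x - 1) ^+ 2) ?sqr_ge0//; ring.
by rewrite divr_ge0 ?sqr_ge0// mulr_ge0// ltW.
Qed.

(** With x = (t + K) / (2 K) outside [0, 1], the sum |x| + |1 - x| is exactly |t| / K. *)
Lemma bernstein_growth K n f C t : 0 < K -> (0 < n)%N ->
  (forall s, `|s| <= K -> `|f s| <= C) -> K < `|t| ->
  `|bernstein K n f t| <= C * (`|t| / K) ^+ n.
Proof.
move=> K0 n0 fC Kt; apply: le_trans (normr_binomial_mean_le _ _ _ _ _) _.
  by move=> k kn; apply: fC; exact: bernstein_node_le.
suff -> : `|(t + K) / (2 * K)| + `|1 - (t + K) / (2 * K)| = `|t| / K by [].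
have -> : 1 - (t + K) / (2 * K) = (K - t) / (2 * K) by field; rewrite gt_eqF.
have K2 : `|2 * K| = 2 * K by rewrite ger0_norm// mulr_ge0// ltW.
rewrite !normf_div K2 -mulrDl.
have [t0|t0] := leP 0 t; move: Kt.
  rewrite (ger0_norm t0) => Kt; rewrite [`|t + K|]ger0_norm ?[`|K - t|]ler0_norm;
    [|lra|lra].
  by field; rewrite gt_eqF.
rewrite (ltr0_norm t0) => Kt; rewrite [`|t + K|]ler0_norm ?[`|K - t|]ger0_norm;
  [|lra|lra].
by field; rewrite gt_eqF.
Qed.

(* The second term absorbs the error outside of [-K, K]; its exponent may be as large
   as one wishes, which makes it integrate to something small against a measure whose
   moments are nearly those of a measure on a strictly smaller interval. *)
Lemma bernstein_global_approx K L A d n m f t :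
  0 < K -> 0 <= L -> 0 <= A -> 0 < d -> (0 < n <= m.*2)%N -> (0 < m)%N ->
  (forall s t, `|s| <= K -> `|t| <= K -> `|f t - f s| <= L * `|t - s|) ->
  (forall t, `|f t| <= A * (1 + t ^+ 2)) ->
  `|f t - bernstein K n f t| <=
    L * (d + K ^+ 2 / (n%:R * d)) + 2 * A * (1 + K ^+ 2) * (t / K) ^+ m.*2.
Proof.
move=> K0 L0 A0 d0 /andP[n0 nm] m0 Lf fA.
have B0 : 0 <= A * (1 + K ^+ 2) by rewrite mulr_ge0// addr_ge0// sqr_ge0.
have sq0 : 0 <= (t / K) ^+ m.*2 by rewrite -mul2n exprM exprn_ge0// sqr_ge0.
have [tK|Kt] := leP `|t| K.
  rewrite ler_wpDr ?bernstein_lipschitz_approx//.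
  by rewrite mulr_ge0// -mulrA mulr_ge0.
rewrite ler_wpDl//.
  by rewrite mulr_ge0// addr_ge0 ?(ltW d0)// divr_ge0 ?sqr_ge0// mulr_ge0// ltW.
have -> : (t / K) ^+ m.*2 = (`|t| / K) ^+ m.*2.
  by rewrite -!mul2n !exprM !expr_div_n real_normK ?num_real.
have tK1 : 1 <= `|t| / K by rewrite ler_pdivlMr// mul1r ltW.
rewrite (le_trans (ler_normB _ _))//.
(* Outside [-K, K] no cancellation is sought: one copy of the bound pays for [f t], the other for
   the approximant. *)
have -> (a b c : R) : 2 * a * b * c = a * b * c + a * b * c by ring.
rewrite lerD//.
- apply: le_trans (fA t) _; rewrite -[t ^+ 2]real_normK ?num_real// -!mulrA.
  rewrite ler_wpM2l//.
  apply: (@le_trans _ _ ((1 + K ^+ 2) * (`|t| / K) ^+ 2)); last first.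
    rewrite ler_wpM2l ?addr_ge0 ?sqr_ge0//.
    by apply: ler_weXn2l => //; rewrite -mul2n leq_pmulr.
  have -> : (1 + K ^+ 2) * (`|t| / K) ^+ 2 = (`|t| / K) ^+ 2 + `|t| ^+ 2.
    by field; rewrite gt_eqF.
  by rewrite lerD2r exprn_ege1.
- apply: le_trans (@bernstein_growth K n f (A * (1 + K ^+ 2)) t K0 n0 _ Kt) _.
    move=> s sK; apply: le_trans (fA s) _; rewrite ler_wpM2l// lerD2l.
    by rewrite -[s ^+ 2]real_normK ?num_real// lerXn2r ?nnegrE// ltW.
  by rewrite ler_wpM2l//; apply: ler_weXn2l.
Qed.
End Bernstein.

(** * Measures with bounded support *)

Section Support.
Context {R : realType}.
Implicit Types (mu : probability R R) (M c C : R) (f : R -> R).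

(** Second countability: each point off the support lies in a null open interval with rational
    endpoints, and [N] enumerates these intervals through the coding of pairs of rationals. *)
Lemma negligible_msupportC mu : mu.-negligible (~` msupport mu).
Proof.
pose N (n : nat) : set R :=
  if unpickle n is Some (p, q) then
    if mu `]ratr p, ratr q[%classic == 0%E then `]ratr p, ratr q[%classic else set0
  else set0.
have N0 n : mu.-negligible (N n).
  rewrite /N; case: unpickle => [[p q]|]; last exact: negligible_set0.
  case: ifPn => [/eqP pq0|_]; last exact: negligible_set0.
  by exists `]ratr p, ratr q[%classic; split => //; exact: measurable_itv.
apply: negligibleS (negligible_bigcup N0) => x /existsNP[r /not_implyP[r0]].
move/negP; rewrite -leNgt measure_le0 => /eqP xr0.
have [p] := @rat_in_itvoo R (x - r) x ltac:(lra).
have [q] := @rat_in_itvoo R x (x + r) ltac:(lra).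
rewrite !in_itv/= => /andP[xq qr] /andP[rp px].
have pq0 : mu `]ratr p, ratr q[%classic = 0%E.
  apply/eqP; rewrite -measure_le0 -xr0 le_measure ?inE//=.
    exact: measurable_ball.
  move=> y /=; rewrite in_itv/= => /andP[py yq].
  by rewrite /ball/= ltr_norml; apply/andP; split; lra.
have [n NE] : exists n, N n = `]ratr p, ratr q[%classic.
  by exists (pickle (p, q)); rewrite /N pickleK pq0 eqxx.
by exists n => //; rewrite NE /= in_itv/= px.
Qed.

Lemma msupport_itv_null mu M : msupport mu `<=` `[- M, M] ->
  mu (~` `[- M, M]%classic) = 0%E.
Proof.
move=> muM; apply/negligibleP; first by apply: measurableC; exact: measurable_itv.
by apply: negligibleS (negligible_msupportC mu); exact: subsetC.
Qed.

(** The complement of [-M, M] is null, so [f] can be averaged over an interval of mass 1. This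
    serves both for moments and for Poisson integrals. *)
Lemma msupport_Rintegral_bounds mu M f c C : msupport mu `<=` `[- M, M] ->
  measurable_fun setT f -> (forall t, `|t| <= M -> c <= f t <= C) ->
  mu.-integrable setT (EFin \o f) /\ c <= \int[mu]_t f t <= C.
Proof.
move=> muM mf fb.
have mN : measurable (~` `[- M, M]%classic) by apply: measurableC; exact: measurable_itv.
have N0 := msupport_itv_null _ _ muM.
have mEf : measurable_fun setT (EFin \o f) by exact/measurable_EFinP.
have DE : setT `\` ~` `[- M, M]%classic = `[- M, M]%classic.
  by rewrite setDE setCK setTI.
have fb' t : `[- M, M]%classic t -> c <= f t <= C.
  by rewrite /= in_itv/= => tM; apply: fb; rewrite ler_norml.
have iD : mu.-integrable `[- M, M]%classic (EFin \o f).
  apply: (@le_integrable _ _ _ _ _ _ _ (EFin \o cst (`|c| + `|C|))) => //.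
  - exact: measurable_funS mEf.
  - move=> t /fb' /andP[cf fC] /=; rewrite lee_fin [leRHS]ger0_norm ?addr_ge0//.
    have := ler_norm C; have := ler_norm (- c); rewrite normrN => h1 h2.
    have := normr_ge0 C; have := normr_ge0 c => h3 h4.
    by rewrite ler_norml; apply/andP; split; lra.
  - exact: finite_measure_integrable_cst.
have iT : mu.-integrable setT (EFin \o f).
  by apply/(negligible_integrable mN measurableT mEf N0); rewrite DE.
split=> //.
have -> : \int[mu]_t f t = \int[mu]_(t in `[- M, M]) f t.
  by rewrite /Rintegral (negligible_integral mN measurableT iT N0) DE.
have D1 : mu `[- M, M]%classic = 1%E.
  have := probability_setC mu mN; rewrite setCK => ->.
  by rewrite N0 sube0.
have intc a : \int[mu]_(_ in `[- M, M]) a = a by rewrite Rintegral_cst//= [X in fine X]D1 mulr1.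
by apply/andP; split; [rewrite -(intc c)|rewrite -[leRHS](intc C)];
  apply: le_Rintegral => //; try exact: finite_measure_integrable_cst;
  move=> t /fb' /andP[].
Qed.

Lemma msupport_finite_moments mu M : msupport mu `<=` `[- M, M] -> finite_moments mu.
Proof.
move=> muM k; apply: (proj1 (msupport_Rintegral_bounds _ _ _ (- M ^+ k) (M ^+ k) muM _ _)).
- exact: exprn_measurable.
- move=> t tM; rewrite -ler_norml normrX lerXn2r ?nnegrE//.
  exact: le_trans tM.
Qed.

Lemma msupport_even_moment_le mu M m : msupport mu `<=` `[- M, M] ->
  moment mu m.*2 <= M ^+ m.*2.
Proof.
move=> muM.
apply: (proj2 (andP (proj2 (msupport_Rintegral_bounds _ _ _ (- M ^+ m.*2) (M ^+ m.*2) muM _ _)))).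
- exact: exprn_measurable.
- move=> t tM; rewrite -ler_norml normrX lerXn2r ?nnegrE//.
  exact: le_trans tM.
Qed.
End Support.

(** * Merging of moments *)

Section Merge.
Context {R : realType}.
Implicit Types (mu : probability R R) (nu nub : nat -> probability R R).
Implicit Types (p q : {poly R}) (f : R -> R) (c : nat -> R) (C eps : R).

Lemma integrable_horner mu p : finite_moments mu ->
  mu.-integrable setT (fun t => (p.[t])%:E).
Proof.
move=> hmu; under eq_fun do rewrite horner_coef -sumEFin.
apply: integrable_sum => // i _; under eq_fun do rewrite EFinM.
exact: integrableZl.
Qed.

Lemma Rintegral_horner mu p : finite_moments mu ->
  \int[mu]_t p.[t] = \sum_(i < size p) p`_i * moment mu i.
Proof.
move=> hmu; under eq_Rintegral do rewrite horner_coef.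
rewrite /Rintegral; under eq_integral do rewrite -sumEFin.
rewrite integral_sum//=; last first.
  by move=> i; under eq_fun do rewrite EFinM; exact: integrableZl.
rewrite -sum_fine; last first.
  move=> i _; apply: integrable_fin_num => //.
  by under eq_fun do rewrite EFinM; exact: integrableZl.
by apply: eq_bigr => i _; rewrite -/(Rintegral _ _ _) RintegralZl//; exact: hmu.
Qed.

Definition moments_merge nu nub := forall k : nat,
  (fun d => `| moment (nu d) k - moment (nub d) k |) @ \oo --> (0 : R).

Lemma cvg_sum0 (I : Type) (s : seq I) (u : I -> nat -> R) :
  (forall i, u i @ \oo --> (0 : R)) ->
  (fun d => \sum_(i <- s) u i d) @ \oo --> (0 : R).
Proof.
move=> u0; elim: s => [|i s IH].
  by under eq_fun do rewrite big_nil; exact: cvg_cst.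
have -> : (fun d => \sum_(j <- i :: s) u j d) = (fun d => u i d + \sum_(j <- s) u j d).
  by apply/funext => d; rewrite big_cons.
by have := cvgD (u0 i) IH; rewrite addr0; exact.
Qed.

Lemma horner_merge nu nub p : moments_merge nu nub ->
  (forall d, finite_moments (nu d)) -> (forall d, finite_moments (nub d)) ->
  (fun d => \int[nu d]_t p.[t] - \int[nub d]_t p.[t]) @ \oo --> (0 : R).
Proof.
move=> hmom hnu hnub.
have -> : (fun d => \int[nu d]_t p.[t] - \int[nub d]_t p.[t])
    = (fun d => \sum_(i < size p) p`_i * (moment (nu d) i - moment (nub d) i)).
  apply/funext => d; rewrite !Rintegral_horner// -sumrB.
  by apply: eq_bigr => i _; rewrite mulrBr.
apply: (@cvg_sum0 _ _ (fun (i : 'I_(size p)) d =>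
  p`_i * (moment (nu d) i - moment (nub d) i))) => i.
have h : (fun d => moment (nu d) i - moment (nub d) i) @ \oo --> (0 : R).
  by apply: norm_cvg0; exact: hmom.
by have := cvgM (cvg_cst p`_i) h; rewrite mulr0; exact.
Qed.

Lemma binomial_mean_horner p n c :
  exists r : {poly R}, forall t, r.[t] = binomial_mean p.[t] n c.
Proof.
elim: n c => /= [|n IH] c; first by exists (c 0%N)%:P => t; rewrite hornerC.
have [r1 r1E] := IH (fun k => c k.+1); have [r2 r2E] := IH c.
by exists (p * r1 + (1 - p) * r2) => t; rewrite !hornerE r1E r2E.
Qed.

Lemma integrable_horner_binomial_mean mu q p n c : finite_moments mu ->
  mu.-integrable setT (fun t => (q.[t] * binomial_mean p.[t] n c)%:E).
Proof.
move=> hmu; have [r rE] := binomial_mean_horner p n c.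
by under eq_fun do rewrite -rE -hornerM; exact: integrable_horner.
Qed.

(** The point is the order of quantifiers: the threshold in [d] is chosen before the values [c]. The
    polynomial weight [q] is there for the induction, as each unfolding of the mean multiplies it by
    [p] or [1 - p]. *)
Lemma binomial_mean_merge nu nub p n q C eps : moments_merge nu nub ->
  (forall d, finite_moments (nu d)) -> (forall d, finite_moments (nub d)) ->
  0 < eps -> \forall d \near \oo, forall c,
    (forall k, (k <= n)%N -> `|c k| <= C) ->
    `|\int[nu d]_t (q.[t] * binomial_mean p.[t] n c)
      - \int[nub d]_t (q.[t] * binomial_mean p.[t] n c)| <= eps.
Proof.
move=> hmom hnu hnub.
elim: n q eps => [|n IH] q eps eps0 /=.
  (* At n = 0 only the integrals of [q] are compared, scaled by c 0; the added 1 keeps the divisor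
     positive. *)
  have C1 : 0 < `|C| + 1 by rewrite ltr_wpDl.
  have /cvgr0Pnorm_le/(_ _ (divr_gt0 eps0 C1)) := horner_merge _ _ q hmom hnu hnub.
  apply: filterS => d dq c /(_ 0%N (leqnn _)) cC.
  rewrite !RintegralZr//; try exact: integrable_horner.
  rewrite -mulrBl normrM -[leRHS](divfK (lt0r_neq0 C1)) ler_pM//.
  by rewrite (le_trans cC)// (le_trans (ler_norm C))// lerDl.
have e2 : 0 < eps / 2 by rewrite divr_gt0.
apply: filterS2 (IH (q * p) _ e2) (IH (q * (1 - p)) _ e2) => d d1 d2 c cC.
have E mu : finite_moments mu ->
    \int[mu]_t (q.[t] * (p.[t] * binomial_mean p.[t] n (fun k => c k.+1)
      + (1 - p.[t]) * binomial_mean p.[t] n c))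
    = \int[mu]_t ((q * p).[t] * binomial_mean p.[t] n (fun k => c k.+1))
      + \int[mu]_t ((q * (1 - p)).[t] * binomial_mean p.[t] n c).
  move=> hmu; rewrite -RintegralD//; try exact: integrable_horner_binomial_mean.
  by apply: eq_Rintegral => t _; rewrite !hornerE; ring.
rewrite !E// opprD addrACA [leRHS]splitr (le_trans (ler_normD _ _))// lerD//.
- by apply: d1 => k kn; apply: cC.
- by apply: d2 => k kn; apply: cC; exact: leqW.
Qed.

Lemma bernsteinE K n f t : bernstein K n f t =
  binomial_mean ((2 * K)^-1 *: ('X + K%:P)).[t] n (fun k => f (bernstein_node K n k)).
Proof. by rewrite /bernstein !hornerE mulrC. Qed.

Lemma integrable_quadratic_growth mu f A : finite_moments mu -> measurable_fun setT f ->
  (forall t, `|f t| <= A * (1 + t ^+ 2)) -> mu.-integrable setT (EFin \o f).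
Proof.
move=> hmu mf fA.
apply: (@le_integrable _ _ _ _ _ _ _ (fun t => (A *: (1 + 'X^2)).[t]%:E)) => //.
- exact/measurable_EFinP.
- by move=> t _ /=; rewrite lee_fin !hornerE (le_trans (fA t))// ler_norm.
- exact: integrable_horner.
Qed.

(** Integrates [bernstein_global_approx]: the error term outside [-K, K] becomes an even moment,
    which is the only quantity in the bound that depends on [mu]. *)
Lemma bernstein_mean_error mu f K L A d n m : finite_moments mu -> measurable_fun setT f ->
  0 < K -> 0 <= L -> 0 <= A -> 0 < d -> (0 < n <= m.*2)%N -> (0 < m)%N ->
  (forall s t, `|s| <= K -> `|t| <= K -> `|f t - f s| <= L * `|t - s|) ->
  (forall t, `|f t| <= A * (1 + t ^+ 2)) ->
  `|\int[mu]_t f t - \int[mu]_t bernstein K n f t| <=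
    L * (d + K ^+ 2 / (n%:R * d)) + 2 * A * (1 + K ^+ 2) * (moment mu m.*2 / K ^+ m.*2).
Proof.
move=> hmu mf K0 L0 A0 d0 nm m0 Lf fA.
set b := L * _; set D := 2 * A * _.
have intf := integrable_quadratic_growth _ _ _ hmu mf fA.
have intb : mu.-integrable setT (EFin \o bernstein K n f).
  have -> : EFin \o bernstein K n f = fun t => ((1 : {poly R}).[t] *
      binomial_mean ((2 * K)^-1 *: ('X + K%:P)).[t] n (fun k => f (bernstein_node K n k)))%:E.
    by apply/funext => t /=; rewrite hornerC mul1r bernsteinE.
  exact: integrable_horner_binomial_mean.
have intX : mu.-integrable setT (fun t => (t ^+ m.*2)%:E) by exact: hmu.
have -> : b + D * (moment mu m.*2 / K ^+ m.*2)
    = \int[mu]_t (b + D / K ^+ m.*2 * t ^+ m.*2).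
  rewrite RintegralD//; last 2 first.
  - exact: finite_measure_integrable_cst.
  - by under [EFin \o _]eq_fun do rewrite /= EFinM; exact: integrableZl.
  rewrite Rintegral_cst// [X in fine X]probability_setT mulr1 RintegralZl//.
  by rewrite /moment /Rintegral; congr (_ + _); ring.
rewrite -RintegralB//.
have intB : mu.-integrable setT (EFin \o (fun t => f t - bernstein K n f t)).
  by under [EFin \o _]eq_fun do rewrite /= EFinB; exact: integrableB.
apply: (le_trans (le_normr_Rintegral _ intB)) => //.
apply: le_Rintegral => //.
- exact: integrable_norm.
- under [EFin \o _]eq_fun do rewrite /= EFinD; apply: integrableD => //.
    exact: finite_measure_integrable_cst.
  by under eq_fun do rewrite EFinM; exact: integrableZl.
- move=> t _.
  have -> : D / K ^+ m.*2 * t ^+ m.*2 = D * (t / K) ^+ m.*2.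
    by rewrite expr_div_n; ring.
  exact: bernstein_global_approx.
Qed.

(** Compare both integrals of [f] with those of its Bernstein approximant. The parameters [n] and
    [m] depend only on [M], [L], [A] and [eps], hence the uniformity over [S]. *)
Lemma uniform_merge nu nub (M L A : R) (S : set (R -> R)) :
  0 < M -> 0 <= L -> 0 <= A -> moments_merge nu nub ->
  (forall d, finite_moments (nu d)) -> (forall d, msupport (nub d) `<=` `[- M, M]) ->
  (forall f, S f -> [/\ measurable_fun setT f,
     forall s t, `|s| <= M + 1 -> `|t| <= M + 1 -> `|f t - f s| <= L * `|t - s|
   & forall t, `|f t| <= A * (1 + t ^+ 2)]) ->
  forall eps, 0 < eps -> \forall d \near \oo, forall f, S f ->
    `|\int[nu d]_t f t - \int[nub d]_t f t| <= eps.
Proof.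
move=> M0 L0 A0 hmom hnu nubM HS eps eps0.
have hnub d : finite_moments (nub d) by exact: msupport_finite_moments (nubM d).
pose K := M + 1; have K0 : 0 < K by rewrite /K; lra.
pose D := 2 * A * (1 + K ^+ 2).
have D0 : 0 <= D by rewrite !mulr_ge0// addr_ge0// sqr_ge0.
have L1 : 0 < L + 1 by lra.
have D1 : 0 < D + 1 by lra.
(* Chosen so that (L + 1) (dl + dl) = eps / 8. The [X] below equals K^2 / dl^2, so n > X gives K^2 /
   (n dl) <= dl. Using [L + 1] avoids dividing by zero. *)
pose dl := eps / (16 * (L + 1)).
have dl0 : 0 < dl by rewrite divr_gt0// mulr_gt0.
have [n n0 nP] : exists2 n : nat, (0 < n)%N & L * (dl + K ^+ 2 / (n%:R * dl)) <= eps / 8.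
  pose X := 16 * (L + 1) * K ^+ 2 / (dl * eps).
  have X0 : 0 < X.
    have LK : 0 < 16 * (L + 1) * K ^+ 2.
      by rewrite mulr_gt0 ?exprn_gt0// mulr_gt0.
    by rewrite divr_gt0// mulr_gt0.
  pose n := (Num.truncn X).+1; exists n => //.
  have Xn : X < n%:R by exact: truncnS_gt.
  have n0 : 0 < n%:R :> R by rewrite ltr0n.
  apply: (@le_trans _ _ ((L + 1) * (dl + K ^+ 2 / (n%:R * dl)))).
    rewrite ler_wpM2r ?lerDl// addr_ge0 ?(ltW dl0)// divr_ge0 ?sqr_ge0//.
    by rewrite mulr_ge0// ltW.
  have -> : eps / 8 = (L + 1) * (dl + dl) by rewrite /dl; field; rewrite gt_eqF.
  rewrite ler_pM2l// lerD2l ler_pdivrMr; last exact: mulr_gt0.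
  have -> : dl * (n%:R * dl) = dl ^+ 2 * n%:R by ring.
  rewrite -ler_pdivrMl ?exprn_gt0//; apply: ltW; apply: le_lt_trans Xn.
  by rewrite /X /dl le_eqVlt; apply/orP; left; apply/eqP; field; rewrite !gt_eqF.
(* Here the margin M < K is used: (M / K)^(2m) tends to 0. The degree [n] is already fixed, and [m]
   is taken beyond it. *)
have [m mn mP] : exists2 m : nat, (n <= m)%N & D * (M ^+ m.*2 / K ^+ m.*2) <= eps / 8.
  have MK : `|(M / K) ^+ 2| < 1.
    rewrite ger0_norm ?sqr_ge0// expr_lt1 ?divr_ge0 ?(ltW M0) ?(ltW K0)//.
    by rewrite ltr_pdivrMr// /K; lra.
  have e8 : 0 < eps / (8 * (D + 1)) by rewrite divr_gt0// mulr_gt0.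
  have /cvgr0Pnorm_le/(_ _ e8)[N _ NP] := cvg_expr MK.
  exists (maxn N n); first exact: leq_maxr.
  have /= := NP (maxn N n) (leq_maxl _ _).
  rewrite -exprM mul2n => h.
  rewrite -expr_div_n; apply: le_trans (ler_wpM2l D0 (ler_norm _)) _.
  apply: le_trans (ler_wpM2l D0 h) _.
  have -> : eps / 8 = (D + 1) * (eps / (8 * (D + 1))) by field; rewrite gt_eqF.
  by rewrite ler_wpM2r ?(ltW e8)// lerDl.
have m0 : (0 < m)%N by exact: leq_trans mn.
have nm2 : (0 < n <= m.*2)%N by rewrite n0 (leq_trans mn)// -addnn leq_addr.
have KX1 : 1 <= K ^+ m.*2 by rewrite exprn_ege1// /K; lra.
have KX0 : 0 < K ^+ m.*2 by exact: lt_le_trans KX1.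
have e4 : 0 < eps / 4 by rewrite divr_gt0.
have eD : 0 < eps / (4 * (D + 1)) by rewrite divr_gt0// mulr_gt0.
have /cvgr0Pnorm_le/(_ _ eD) := hmom m.*2.
have := @binomial_mean_merge nu nub ((2 * K)^-1 *: ('X + K%:P)) n 1
  (A * (1 + K ^+ 2)) (eps / 4) hmom hnu hnub e4.
apply: filterS2 => d dB dm f /HS[mf Lf fA].
have fK s : `|s| <= K -> `|f s| <= A * (1 + K ^+ 2).
  move=> sK; apply: le_trans (fA s) _; rewrite ler_wpM2l// lerD2l.
  by rewrite -[s ^+ 2]real_normK ?num_real// lerXn2r ?nnegrE// ltW.
have {}dB : `|\int[nu d]_t bernstein K n f t - \int[nub d]_t bernstein K n f t| <= eps / 4.
  have := dB (fun k => f (bernstein_node K n k)).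
  under eq_Rintegral do rewrite hornerC mul1r -bernsteinE.
  under [X in _ - X]eq_Rintegral do rewrite hornerC mul1r -bernsteinE.
  by apply => k kn; apply: fK; exact: bernstein_node_le.
have E1 := @bernstein_mean_error (nu d) f K L A dl n m (hnu d) mf K0 L0 A0 dl0 nm2 m0 Lf fA.
have E2 := @bernstein_mean_error (nub d) f K L A dl n m (hnub d) mf K0 L0 A0 dl0 nm2 m0 Lf fA.
rewrite -/D in E1 E2.
have mb := @msupport_even_moment_le _ (nub d) M m (nubM d).
have {}mb : D * (moment (nub d) m.*2 / K ^+ m.*2) <= eps / 8.
  by apply: le_trans mP; rewrite ler_wpM2l// ler_pM2r ?invr_gt0.
(* The support bound is available only for [nub d]; it passes to [nu d] through convergence of the
   2m-th moments, and K^(2m) >= 1 lets the discrepancy lose its denominator. *)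
have mn' : D * (moment (nu d) m.*2 / K ^+ m.*2) <= eps / 8 + eps / 4.
  rewrite normr_id in dm.
  have ab : moment (nu d) m.*2 <= moment (nub d) m.*2 + eps / (4 * (D + 1)).
    by rewrite -lerBlDl (le_trans (ler_norm _)).
  apply: le_trans (lerD mb (lexx (eps / 4))).
  apply: (@le_trans _ _ (D * ((moment (nub d) m.*2 + eps / (4 * (D + 1))) / K ^+ m.*2))).
    by rewrite ler_wpM2l// ler_pM2r ?invr_gt0.
  rewrite mulrDl mulrDr lerD2l.
  have -> : eps / 4 = (D + 1) * (eps / (4 * (D + 1))) by field; rewrite gt_eqF.
  rewrite ler_pM// ?lerDl//; first by rewrite divr_ge0// ltW.
  by rewrite ler_pdivrMr// ler_peMr// ltW.
(* The budget is eps / 2 for the approximation under [nu d], eps / 4 under [nub d], and eps / 4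
   between the approximants. *)
move: E1 E2 dB; rewrite !ler_norml => /andP[? ?] /andP[? ?] /andP[? ?].
by apply/andP; split; lra.
Qed.
End Merge.

(** * The Poisson kernel *)

Section Poisson.
Context {R : realType}.
Implicit Types (mu : probability R R) (g x y s t M : R).

Lemma Poisson_gt0 g x : 0 < g -> 0 < Poisson g x.
Proof.
by move=> g0; rewrite divr_gt0// mulr_gt0 ?pi_gt0// ltr_wpDl ?sqr_ge0// exprn_gt0.
Qed.

Lemma Poisson_le g x : 0 < g -> Poisson g x <= (pi * g)^-1.
Proof.
move=> g0; rewrite /Poisson; move: (@pi R) (pi_gt0 R) => p p0.
have x0 := sqr_ge0 x; have g2 : 0 < g ^+ 2 by rewrite exprn_gt0.
have -> : (p * g)^-1 = g / (p * g ^+ 2) by field; rewrite !gt_eqF.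
have x2 : 0 < x ^+ 2 + g ^+ 2 by lra.
rewrite ler_pM2l// lef_pV2 ?posrE ?mulr_gt0//.
by rewrite ler_pM2l// lerDr.
Qed.

(** A convenient, not optimal, Harnack factor: it equals 1 at 0, so that [Harnack g x - 1] can act
    as a modulus of continuity, and it grows only quadratically. *)
Definition Harnack g x : R := 1 + `|x| / g + (`|x| / g) ^+ 2.

Lemma Harnack_ge1 g x : 0 < g -> 1 <= Harnack g x.
Proof.
by move=> g0; rewrite /Harnack -addrA lerDl addr_ge0 ?sqr_ge0// divr_ge0// ltW.
Qed.

Lemma Harnack_gt0 g x : 0 < g -> 0 < Harnack g x.
Proof. by move=> g0; apply: lt_le_trans (Harnack_ge1 _ _ g0). Qed.

(** After clearing denominators, with |x - y| = h g, this is x^2 <= y^2 + 2 |y| h g + h^2 g^2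
    combined with 2 |y| g <= y^2 + g^2. *)
Lemma Poisson_Harnack g x y : 0 < g -> Poisson g y <= Harnack g (x - y) * Poisson g x.
Proof.
move=> g0; rewrite /Poisson; move: (@pi R) (pi_gt0 R) => p p0.
have g2 : 0 < g ^+ 2 by rewrite exprn_gt0.
have x2 : 0 < x ^+ 2 + g ^+ 2 by have := sqr_ge0 x; lra.
have y2 : 0 < y ^+ 2 + g ^+ 2 by have := sqr_ge0 y; lra.
rewrite mulrCA ler_pM2l// ler_pdivlMr ?mulr_gt0// ler_pdivrMl ?mulr_gt0//.
have -> : p * (y ^+ 2 + g ^+ 2) * Harnack g (x - y)
    = p * ((y ^+ 2 + g ^+ 2) * Harnack g (x - y)) by rewrite mulrA.
rewrite ler_pM2l// /Harnack; set h := `|x - y| / g.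
have h0 : 0 <= h by rewrite divr_ge0// ltW.
have xE : `|x - y| = h * g by rewrite /h divfK// gt_eqF.
have x2E : x ^+ 2 <= y ^+ 2 + 2 * `|y| * (h * g) + (h * g) ^+ 2.
  rewrite -{2}xE -{1}xE real_normK ?num_real// -subr_ge0.
  have -> : y ^+ 2 + 2 * `|y| * `|x - y| + (x - y) ^+ 2 - x ^+ 2
    = 2 * (`|y| * `|x - y| - y * (x - y)) by ring.
  by rewrite mulr_ge0// subr_ge0 -normrM ler_norm.
have yg : 2 * `|y| * g <= y ^+ 2 + g ^+ 2.
  by have := sqr_ge0 (`|y| - g); rewrite sqrrB real_normK ?num_real//; lra.
have yy := sqr_ge0 y.
have : 0 <= h * (y ^+ 2 + g ^+ 2 - 2 * `|y| * g) by rewrite mulr_ge0// subr_ge0.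
have : 0 <= h ^+ 2 * y ^+ 2 by rewrite mulr_ge0 ?sqr_ge0.
lra.
Qed.

(** Harnack in both directions with the same factor q. For the lower side, b >= a / q >= (2 - q)
    a. *)
Lemma Poisson_dist g x s t : 0 < g ->
  `|Poisson g (x - t) - Poisson g (x - s)|
  <= (Harnack g (t - s) - 1) * Poisson g (x - s).
Proof.
move=> g0; have := Poisson_Harnack g (x - s) (x - t) g0.
have := Poisson_Harnack g (x - t) (x - s) g0.
have -> : x - s - (x - t) = t - s by ring.
have -> : x - t - (x - s) = - (t - s) by ring.
have -> : Harnack g (- (t - s)) = Harnack g (t - s) by rewrite /Harnack normrN.
have := Poisson_gt0 g (x - s) g0; have := Poisson_gt0 g (x - t) g0.
move: (Poisson g (x - s)) (Poisson g (x - t)) => a b.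
have := Harnack_ge1 g (t - s) g0.
move: (Harnack _ _) => q q1 b0 a0 h1 h2.
rewrite ler_norml; apply/andP; split; nra.
Qed.

Lemma Poisson_lower g M x t : 0 < g -> 0 < M -> `|t| <= M ->
  g / (pi * ((1 + M) ^+ 2 + g ^+ 2)) / (1 + `|x|) ^+ 2 <= Poisson g (x - t).
Proof.
move=> g0 M0 tM; rewrite /Poisson; move: (@pi R) (pi_gt0 R) => p p0.
have g2 : 0 < g ^+ 2 by rewrite exprn_gt0.
have x0 := normr_ge0 x.
have M2 : 0 < (1 + M) ^+ 2 + g ^+ 2 by have := sqr_ge0 (1 + M); lra.
have x2 : 0 < (x - t) ^+ 2 + g ^+ 2 by have := sqr_ge0 (x - t); lra.
have x1 : 0 < (1 + `|x|) ^+ 2 by rewrite exprn_gt0// ltr_wpDr.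
rewrite -mulrA ler_pM2l// -invfM lef_pV2 ?posrE ?mulr_gt0//.
rewrite -mulrA ler_pM2l//.
have : (x - t) ^+ 2 <= (`|x| + M) ^+ 2.
  rewrite -[leLHS]real_normK ?num_real// lerXn2r ?nnegrE ?addr_ge0// ?(ltW M0)//.
  by rewrite (le_trans (ler_normB _ _))// lerD2l.
have : (`|x| + M) ^+ 2 <= ((1 + M) * (1 + `|x|)) ^+ 2.
  by rewrite lerXn2r ?nnegrE ?mulr_ge0 ?addr_ge0// ?(ltW M0)//; nra.
rewrite exprMn; have : g ^+ 2 <= g ^+ 2 * (1 + `|x|) ^+ 2.
  by rewrite ler_peMr// ?(ltW g2)// exprn_ege1// lerDl.
lra.
Qed.

(** From (1 + |x|)^2 <= 2 (1 + x^2) and 1 + x^2 <= (1 + g^-2) (x^2 + g^2). *)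
Lemma Poisson_upper g x : 0 < g ->
  Poisson g x <= 2 * g * (1 + g ^- 2) / pi / (1 + `|x|) ^+ 2.
Proof.
move=> g0; rewrite /Poisson; move: (@pi R) (pi_gt0 R) => p p0.
have g2 : 0 < g ^+ 2 by rewrite exprn_gt0.
have x2 : 0 < x ^+ 2 + g ^+ 2 by have := sqr_ge0 x; lra.
have x1 : 0 < (1 + `|x|) ^+ 2 by rewrite exprn_gt0// ltr_wpDr.
rewrite ler_pdivlMr// ler_pdivlMr//.
have -> : g / (p * (x ^+ 2 + g ^+ 2)) * (1 + `|x|) ^+ 2 * p
  = g * ((1 + `|x|) ^+ 2 / (x ^+ 2 + g ^+ 2)) by field; rewrite !gt_eqF.
rewrite (_ : 2 * g * (1 + g ^- 2) = g * (2 * (1 + g ^- 2))); last by ring.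
rewrite ler_pM2l// ler_pdivrMr//.
have gg : g ^- 2 * g ^+ 2 = 1 by rewrite mulVf// gt_eqF.
have : 0 <= g ^- 2 * `|x| ^+ 2 by rewrite mulr_ge0 ?sqr_ge0// invr_ge0 sqr_ge0.
rewrite -[x ^+ 2]real_normK ?num_real//; have := sqr_ge0 (1 - `|x|).
have -> : 2 * (1 + g ^- 2) * (`|x| ^+ 2 + g ^+ 2)
  = 2 * (`|x| ^+ 2 + g ^+ 2 + g ^- 2 * `|x| ^+ 2 + g ^- 2 * g ^+ 2) by ring.
by rewrite gg; have := sqr_ge0 g; nra.
Qed.

Lemma measurable_Poisson g : 0 < g -> measurable_fun setT (Poisson g).
Proof.
move=> g0; apply: continuous_measurable_fun => x.
apply: cvgM; first exact: cvg_cst.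
apply: cvgV.
  by rewrite gt_eqF// mulr_gt0 ?pi_gt0// ltr_wpDl ?sqr_ge0// exprn_gt0.
apply: cvgM; first exact: cvg_cst.
apply: cvgD; last exact: cvg_cst.
exact: exprn_continuous.
Qed.

Lemma measurable_Poisson_diff g : 0 < g ->
  measurable_fun setT (fun z : R * R => Poisson g (z.1 - z.2)).
Proof.
move=> g0; apply: (@measurableT_comp _ _ _ _ _ _ (Poisson g)).
  exact: measurable_Poisson.
exact: measurable_funB.
Qed.

Lemma measurable_Poisson_shift g x : 0 < g ->
  measurable_fun setT (fun t => Poisson g (x - t)).
Proof.
move=> g0; apply: (@measurableT_comp _ _ _ _ _ _ (Poisson g)).
  exact: measurable_Poisson.
exact: measurable_funB.
Qed.

Lemma integrable_Poisson g mu x : 0 < g ->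
  mu.-integrable setT (EFin \o (fun t => Poisson g (x - t))).
Proof.
move=> g0.
apply: (@le_integrable _ _ _ _ _ _ _ (EFin \o cst (pi * g)^-1)) => //.
- by apply/measurable_EFinP; exact: measurable_Poisson_shift.
- move=> t _ /=; rewrite lee_fin ger0_norm ?(ltW (Poisson_gt0 _ _ _))//.
  by rewrite (le_trans (Poisson_le _ _ _))// ler_norm.
- exact: finite_measure_integrable_cst.
Qed.

(** The imaginary part of 1 / (x - t + i g) is -pi times the Poisson kernel at x - t; from here on
    complex numbers disappear. *)
Lemma ellE g x mu : 0 < g -> ell g x mu = - ln (Pconv g mu x).
Proof.
move=> g0; rewrite /ell; congr (- ln _).
have -> : ImG mu (x +i* g)%C = \int[mu]_t (- pi * Poisson g (x - t)).
  apply: eq_Rintegral => t _ /=.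
  rewrite /Poisson subr0; move: (@pi R) (pi_gt0 R) => p p0.
  have g2 : 0 < (x - t) ^+ 2 + g ^+ 2 by rewrite ltr_wpDl ?sqr_ge0// exprn_gt0.
  by field; rewrite !gt_eqF.
rewrite RintegralZl//; last exact: integrable_Poisson.
by rewrite mulrA mulrNN mulVf ?mul1r// gt_eqF// pi_gt0.
Qed.
End Poisson.

(** * Bounds on [ell] uniform over [BM M], and an integrable majorant *)

Section Domination.
Context {R : realType}.
Implicit Types (mu : probability R R) (g x y s t M : R).
Local Notation leb := (@lebesgue_measure R).

Lemma Pconv_bounds g M mu x : 0 < g -> 0 < M -> BM M mu ->
  g / (pi * ((1 + M) ^+ 2 + g ^+ 2)) / (1 + `|x|) ^+ 2 <= Pconv g mu x <= (pi * g)^-1.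
Proof.
move=> g0 M0 muM.
apply: (proj2 (msupport_Rintegral_bounds mu M (fun t => Poisson g (x - t)) _ _ muM _ _)).
- exact: measurable_Poisson_shift.
- by move=> t tM; rewrite Poisson_lower//= Poisson_le.
Qed.

(** Write ln y as twice the logarithm of the square root and use ln z < z. *)
Lemma ln_le_powR_half y : 0 < y -> ln y <= 2 * y `^ 2^-1.
Proof.
move=> y0; have := ltW (@ln_sublinear R (y `^ 2^-1) (powR_gt0 _ y0)).
by rewrite ln_powR; lra.
Qed.

Lemma ell_bound g M : 0 < g -> 0 < M -> exists2 C : R, 0 <= C &
  forall mu x, BM M mu -> `|ell g x mu| <= C * (1 + `|x|) `^ 2^-1.
Proof.
move=> g0 M0; pose c : R := g / (pi * ((1 + M) ^+ 2 + g ^+ 2)).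
have c0 : 0 < c.
  by rewrite divr_gt0// mulr_gt0 ?pi_gt0// ltr_wpDl ?sqr_ge0// exprn_gt0.
have b0 : 0 < (pi * g)^-1 by rewrite invr_gt0 mulr_gt0// pi_gt0.
(* The 4 absorbs 2 ln (1 + |x|), which comes from the inverse square lower bound on [Pconv]; the
   constants are absorbed since the square root is at least 1. *)
exists (4 + `|ln c| + `|ln (pi * g)^-1|); first by rewrite !addr_ge0.
move=> mu x muM; rewrite ellE// normrN.
have y1 : 1 <= 1 + `|x| by rewrite lerDl.
have y0 : 0 < 1 + `|x| by exact: lt_le_trans y1.
have y2 : 0 < (1 + `|x|) ^+ 2 by rewrite exprn_gt0.
have /andP[lo up] := Pconv_bounds g M mu x g0 M0 muM.
have cy : 0 < c / (1 + `|x|) ^+ 2 by rewrite divr_gt0.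
have P0 : 0 < Pconv g mu x by exact: lt_le_trans lo.
have {}lo : ln c - ln (1 + `|x|) *+ 2 <= ln (Pconv g mu x).
  by rewrite -lnXn// -ln_div ?posrE// ler_ln ?posrE//; exact: lo.
have {}up : ln (Pconv g mu x) <= ln (pi * g)^-1 by rewrite ler_ln ?posrE.
move: lo up; have := ln_le_powR_half _ y0.
have : 1 <= (1 + `|x|) `^ 2^-1.
  by rewrite -[leLHS](powRr0 (1 + `|x|)) ler_powR// invr_ge0.
move: (_ `^ _) (ln c) (ln (pi * g)^-1) => w u v w1 lw lo up.
have := ler_norm v; have := ler_norm (- u); rewrite normrN.
have : `|u| <= `|u| * w by rewrite ler_peMr.
have : `|v| <= `|v| * w by rewrite ler_peMr.
move: (normr_ge0 u) (normr_ge0 v); move: `|u| `|v| => a b a0 b0' bw aw h1 h2.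
by rewrite ler_norml; apply/andP; split; lra.
Qed.

Lemma continuous_powR_1Dnorm (p : R) : continuous (fun x : R => (1 + `|x|) `^ p).
Proof.
move=> x; have x0 : 0 < 1 + `|x| by rewrite ltr_wpDr.
apply: (@continuous_comp _ _ _ (fun x : R => 1 + `|x|) (fun a => a `^ p)).
  by apply: cvgD; [exact: cvg_cst|exact: norm_continuous].
apply: differentiable_continuous; apply/derivable1_diffP.
by apply: derivable_powR; rewrite in_itv/= x0.
Qed.

Lemma integral_powR_1Dnorm_half_line :
  (\int[leb]_(x in `[0%R, +oo[) ((1 + `|x|) `^ (- (3 / 2)))%:E = 2%:E)%E.
Proof.
(* An antiderivative on the half line, where |x| = x; it vanishes at infinity and F 0 = -2. *)
pose F x : R := - 2 * (1 + x) `^ (- 2^-1).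
have dF x : 0 <= x -> is_derive x 1 F ((1 + `|x|) `^ (- (3 / 2))).
  move=> x0; have x1 : 0 < 1 + x by lra.
  have h1 : is_derive x 1 (fun x : R => 1 + x) 1.
    exact: (is_derive_eq (is_deriveD (is_derive_cst (1 : R) x 1) (is_derive_id x 1)) (add0r 1)).
  have h2 := is_derive1_comp (is_derive1_powR (- 2^-1) x1) h1.
  apply: (is_derive_eq (is_deriveZ (- 2) h2)).
  rewrite ger0_norm// (_ : - 2^-1 - 1 = - (3 / 2)); last by field.
  by rewrite /GRing.scale/=; field.
rewrite (@ge0_continuous_FTC2y _ _ F 0 0)//.
- by rewrite /F addr0 powR1 mulr1 sub0e EFinN oppeK.
- by apply: continuous_subspaceT; exact: continuous_powR_1Dnorm.
- apply/cvgr0Pnorm_le => e e0.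
  near=> x.
  have x0 : (2 / e) ^+ 2 <= x by near: x; apply: nbhs_pinfty_ge; exact: num_real.
  have x1 : (2 / e) ^+ 2 <= 1 + x by lra.
  have e2 : 0 < (2 / e) ^+ 2 by rewrite exprn_gt0// divr_gt0.
  have x2 : 0 < 1 + x by exact: lt_le_trans x1.
  rewrite /F powRN powR12_sqrt ?(ltW x2)// normrM normrN normfV !ger0_norm//.
  rewrite ler_pdivrMr ?sqrtr_gt0// mulrC -ler_pdivrMr//.
  rewrite -[leLHS]ger0_norm; last by rewrite divr_ge0// ltW.
  by rewrite -sqrtr_sqr ler_wsqrtr.
- by move=> x /ltW x0; have [] := dF x x0.
- apply: cvg_at_right_filter; apply: differentiable_continuous.
  by apply/derivable1_diffP; have [] := dF 0 (lexx _).
- move=> x; rewrite in_itv/= andbT => /ltW x0; rewrite derive1E.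
  by have [_ ->] := dF x x0.
Unshelve. all: by end_near. Qed.

Lemma integrable_powR_1Dnorm :
  leb.-integrable setT (fun x : R => ((1 + `|x|) `^ (- (3 / 2)))%:E).
Proof.
apply/integrableP; split.
  apply/measurable_EFinP; apply: continuous_measurable_fun; exact: continuous_powR_1Dnorm.
under eq_integral do rewrite gee0_abs ?lee_fin ?powR_ge0//.
rewrite ge0_symfun_integralT//.
- by rewrite -set_itvcy integral_powR_1Dnorm_half_line ltry.
- exact: continuous_powR_1Dnorm.
- by move=> x /=; rewrite normrN.
Qed.

Lemma measurable_Pconv g mu : 0 < g -> measurable_fun setT (Pconv g mu).
Proof.
move=> g0; rewrite /Pconv.
apply: (@measurableT_comp _ _ _ _ _ _ fine) => //.
apply: (@measurable_fun_fubini_tonelli_F _ _ _ _ _ mu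
  (fun z : R * R => (Poisson g (z.1 - z.2))%:E)).
- by apply/measurable_EFinP; exact: measurable_Poisson_diff.
- by move=> z; rewrite lee_fin ltW// Poisson_gt0.
Qed.

Lemma measurable_ell g mu : 0 < g -> measurable_fun setT (fun x => ell g x mu).
Proof.
move=> g0; rewrite (_ : (fun x => ell g x mu) = -%R \o (@ln R \o Pconv g mu)).
  apply: measurableT_comp => //; apply: measurableT_comp => //.
  exact: measurable_Pconv.
by apply/funext => x; rewrite ellE.
Qed.

(** Growth of order 1/2 against decay of order 2 leaves the exponent -3/2, which is integrable. The
    bound [A] is the integral of this majorant and so does not depend on [mu]. *)
Lemma ell_Poisson_integrable g M : 0 < g -> 0 < M -> exists2 A : R, 0 <= A &
  forall mu, BM M mu ->
    leb.-integrable setT (fun x : R => (ell g x mu * Poisson g x)%:E)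
    /\ (\int[leb]_x `|ell g x mu * Poisson g x|%:E <= A%:E)%E.
Proof.
move=> g0 M0; have [C C0 HC] := ell_bound g M g0 M0.
pose D : R := 2 * g * (1 + g ^- 2) / pi.
have D0 : 0 <= D.
  by rewrite !mulr_ge0// ?invr_ge0 ?pi_ge0// ?addr_ge0// ?(ltW g0)// invr_ge0 sqr_ge0.
pose W x : R := C * D * (1 + `|x|) `^ (- (3 / 2)).
have W0 x : 0 <= W x by rewrite mulr_ge0 ?powR_ge0// mulr_ge0.
have intW : leb.-integrable setT (EFin \o W).
  by under [EFin \o _]eq_fun do rewrite /= EFinM; apply: integrableZl => //;
    exact: integrable_powR_1Dnorm.
have eW mu x : BM M mu -> `|ell g x mu * Poisson g x| <= W x.
  move=> muM; have x0 : 0 < 1 + `|x| by rewrite ltr_wpDr.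
  rewrite normrM (ger0_norm (ltW (Poisson_gt0 g x g0))).
  apply: (le_trans (ler_pM _ _ (HC mu x muM) (Poisson_upper g x g0))) => //.
    by rewrite ltW// Poisson_gt0.
  rewrite -/D /W mulrACA ler_wpM2l ?(mulr_ge0 C0 D0)//.
  rewrite -powR_invn ?(ltW x0)// -powRD; last by apply/implyP => _; rewrite gt_eqF.
  by rewrite le_eqVlt; apply/orP; left; apply/eqP; congr (_ `^ _); field.
exists (fine (\int[leb]_x (W x)%:E)%E).
  by rewrite fine_ge0// integral_ge0// => x _; rewrite lee_fin.
move=> mu muM.
have mE : measurable_fun setT (fun x => ell g x mu * Poisson g x).
  by apply: measurable_funM; [exact: measurable_ell|exact: measurable_Poisson].
split.
- apply: le_integrable intW => //; first exact/measurable_EFinP.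
  by move=> x _; rewrite /= lee_fin [leRHS]ger0_norm// eW.
- rewrite fineK; last exact: integrable_fin_num.
  apply: ge0_le_integral => //=.
  + by apply/measurable_EFinP; exact: measurableT_comp.
  + by case/integrableP : intW.
  + by move=> x _; rewrite lee_fin eW.
Qed.
End Domination.

(** * The pairing with the Poisson kernel *)

Section Pairing.
Context {R : realType}.
Implicit Types (nu mu : probability R R) (g x s t : R) (e : R -> R).
Local Notation leb := (@lebesgue_measure R).

(** For [e] equal to [ell g] at a fixed [mu], this is phi_mu. Only integrability of [e] against the
    kernel centred at 0 will be used; Harnack's inequality transports it to every [t]. *)
Definition Poisson_pairing g e t : R := \int[leb]_x (e x * Poisson g (x - t)).

Lemma measurable_Poisson_pairing_shift g e t : 0 < g -> measurable_fun setT e ->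
  measurable_fun setT (fun x => e x * Poisson g (x - t)).
Proof.
move=> g0 me; apply: measurable_funM => //.
apply: (@measurableT_comp _ _ _ _ _ _ (Poisson g)); first exact: measurable_Poisson.
exact: measurable_funB.
Qed.

Lemma normrM_Poisson g (a : R) x : 0 < g -> `|a * Poisson g x| = `|a| * Poisson g x.
Proof. by move=> g0; rewrite normrM [X in _ * X]gtr0_norm// Poisson_gt0. Qed.

Lemma Poisson_pairing_pointwise g e x s t : 0 < g ->
  `|e x * Poisson g (x - t)| <= Harnack g (t - s) * `|e x * Poisson g (x - s)|.
Proof.
move=> g0; rewrite !normrM_Poisson// [leRHS]mulrCA ler_wpM2l//.
have := Poisson_Harnack g (x - s) (x - t) g0.
by have -> : x - s - (x - t) = t - s by ring.
Qed.

Lemma integrable_Poisson_pairing g e t : 0 < g -> measurable_fun setT e ->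
  leb.-integrable setT (fun x : R => (e x * Poisson g x)%:E) ->
  leb.-integrable setT (fun x : R => (e x * Poisson g (x - t))%:E).
Proof.
move=> g0 me ie.
have H0 := ltW (Harnack_gt0 g (t - 0) g0).
have iH := integrableZl measurableT (Harnack g (t - 0)) ie.
apply: le_integrable iH => //.
- by apply/measurable_EFinP; exact: measurable_Poisson_pairing_shift.
- move=> x _; rewrite -EFinM !abse_EFin lee_fin [leRHS]normrM (ger0_norm H0).
  by have := Poisson_pairing_pointwise g e x 0 t g0; rewrite [x - 0]subr0.
Qed.

Lemma integral_abs_Poisson_pairing g e A t : 0 < g -> measurable_fun setT e ->
  (\int[leb]_x `|e x * Poisson g x|%:E <= A%:E)%E ->
  (\int[leb]_x `|e x * Poisson g (x - t)|%:E <= (Harnack g t * A)%:E)%E.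
Proof.
move=> g0 me eA; have H0 := ltW (Harnack_gt0 g t g0).
have mP : measurable_fun setT (fun x => `|e x * Poisson g (x - t)|).
  by apply: measurableT_comp => //; exact: measurable_Poisson_pairing_shift.
have mP0 : measurable_fun setT (fun x => `|e x * Poisson g x|).
  apply: measurableT_comp => //; apply: measurable_funM => //.
  exact: measurable_Poisson.
apply: (@le_trans _ _ (\int[leb]_x (Harnack g t * `|e x * Poisson g x|)%:E)%E).
  apply: ge0_le_integral => //=.
  - exact/measurable_EFinP.
  - by apply/measurable_EFinP; exact: measurable_funM.
  - move=> x _; rewrite lee_fin.
    by have := Poisson_pairing_pointwise g e x 0 t g0; rewrite !subr0.
under eq_integral do rewrite EFinM.
rewrite ge0_integralZl_EFin//; last exact/measurable_EFinP.
by rewrite EFinM lee_wpmul2l.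
Qed.

Lemma Poisson_pairing_bound g e A t : 0 < g -> measurable_fun setT e ->
  leb.-integrable setT (fun x : R => (e x * Poisson g x)%:E) ->
  (\int[leb]_x `|e x * Poisson g x|%:E <= A%:E)%E ->
  \int[leb]_x `|e x * Poisson g (x - t)| <= Harnack g t * A.
Proof.
move=> g0 me ie eA; have := integral_abs_Poisson_pairing g e A t g0 me eA.
have h : leb.-integrable setT (EFin \o (fun x : R => `|e x * Poisson g (x - t)|)).
  exact: (integrable_norm (integrable_Poisson_pairing g e t g0 me ie)).
by rewrite -lee_fin /Rintegral fineK//; exact: integrable_fin_num.
Qed.

Lemma Poisson_pairing_le g e A t : 0 < g -> measurable_fun setT e ->
  leb.-integrable setT (fun x : R => (e x * Poisson g x)%:E) ->
  (\int[leb]_x `|e x * Poisson g x|%:E <= A%:E)%E ->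
  `|Poisson_pairing g e t| <= Harnack g t * A.
Proof.
move=> g0 me ie eA.
apply: le_trans (Poisson_pairing_bound g e A t g0 me ie eA).
by apply: le_normr_Rintegral => //; exact: integrable_Poisson_pairing.
Qed.

(** Integrate [Poisson_dist] against |e|, then bound the kernel at [s] by the one at 0. *)
Lemma Poisson_pairing_dist g e A s t : 0 < g -> measurable_fun setT e ->
  leb.-integrable setT (fun x : R => (e x * Poisson g x)%:E) ->
  (\int[leb]_x `|e x * Poisson g x|%:E <= A%:E)%E ->
  `|Poisson_pairing g e t - Poisson_pairing g e s|
  <= (Harnack g (t - s) - 1) * (Harnack g s * A).
Proof.
move=> g0 me ie eA.
have It := integrable_Poisson_pairing g e t g0 me ie.
have Is := integrable_Poisson_pairing g e s g0 me ie.
have H0 : 0 <= Harnack g (t - s) - 1 by rewrite subr_ge0 Harnack_ge1.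
rewrite /Poisson_pairing -RintegralB//.
apply: le_trans (ler_wpM2l H0 (Poisson_pairing_bound g e A s g0 me ie eA)).
have Ins := integrable_norm Is.
rewrite -RintegralZl//.
apply: le_trans (le_normr_Rintegral _ _) _ => //.
  by have := integrableB measurableT It Is.
apply: le_Rintegral => //.
- by have := integrable_norm (integrableB measurableT It Is).
- by have := integrableZl measurableT (Harnack g (t - s) - 1) Ins.
- move=> x _; rewrite -mulrBr normrM normrM_Poisson//.
  by rewrite [leRHS]mulrCA ler_wpM2l// Poisson_dist.
Qed.

Lemma Harnack_le_quadratic g : 0 < g -> exists2 B : R, 0 <= B &
  forall t, Harnack g t <= B * (1 + t ^+ 2).
Proof.
move=> g0; exists (1 + g^-1 + g^-1 ^+ 2).
  by rewrite !addr_ge0 ?sqr_ge0// invr_ge0 ltW.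
move=> t; rewrite /Harnack exprMn -[t ^+ 2]real_normK ?num_real//.
have := normr_ge0 t; move: `|t| => u u0.
have gi0 : 0 <= g^-1 by rewrite invr_ge0 ltW.
move: g^-1 gi0 => k k0.
have u1 : u <= 1 + u ^+ 2 by have := sqr_ge0 (u - 1); nra.
have := ler_wpM2r k0 u1; have := sqr_ge0 u; have := sqr_ge0 k; nra.
Qed.

Lemma measurable_Harnack g : measurable_fun setT (Harnack g).
Proof.
apply: measurable_funD; first apply: measurable_funD => //.
- by apply: measurable_funM => //; exact: measurable_normr.
- apply: measurable_funX; apply: measurable_funM => //; exact: measurable_normr.
Qed.

(** By Tonelli, integrating first in [x]: the inner integral is at most [Harnack g t * A], of
    quadratic growth, hence [nu]-integrable. *)
Lemma Poisson_pairing_integrable_prod g e A nu : 0 < g -> measurable_fun setT e ->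
  finite_moments nu -> (\int[leb]_x `|e x * Poisson g x|%:E <= A%:E)%E ->
  (leb \x nu)%E.-integrable setT (fun z => (e z.1 * Poisson g (z.1 - z.2))%:E).
Proof.
move=> g0 me hnu eA.
have [B B0 HB] := Harnack_le_quadratic g g0.
apply/integrable21ltyP.
  apply/measurable_EFinP; apply: measurable_funM; first exact: measurableT_comp.
  exact: measurable_Poisson_diff.
have iH : nu.-integrable setT (EFin \o Harnack g).
  apply: (integrable_quadratic_growth _ _ B) => //; first exact: measurable_Harnack.
  by move=> t; rewrite ger0_norm ?HB// ltW// Harnack_gt0.
have iHA := integrableZr measurableT A iH.
apply: (@le_lt_trans _ _ (\int[nu]_t ((Harnack g t)%:E * A%:E))%E); last first.
  exact: integrable_lty iHA.
apply: ge0_le_integral => //=.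
- by move=> t _; exact: integral_ge0.
- apply: (@measurable_fun_fubini_tonelli_G _ _ _ _ _ leb
    (fun z : measurableTypeR R * R => `|(e z.1 * Poisson g (z.1 - z.2))%:E|%E)) => //.
  apply: measurableT_comp => //; apply/measurable_EFinP.
  apply: measurable_funM; first exact: measurableT_comp.
  exact: measurable_Poisson_diff.
- exact: measurable_int iHA.
- by move=> t _; rewrite -EFinM; exact: integral_abs_Poisson_pairing.
Qed.

Lemma measurable_Poisson_pairing g e A nu : 0 < g -> measurable_fun setT e ->
  finite_moments nu -> (\int[leb]_x `|e x * Poisson g x|%:E <= A%:E)%E ->
  measurable_fun setT (Poisson_pairing g e).
Proof.
move=> g0 me hnu eA.
apply: (@measurableT_comp _ _ _ _ _ _ fine) => //.
exact: measurable_fubini_G (Poisson_pairing_integrable_prod g e A nu g0 me hnu eA).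
Qed.

Lemma Poisson_pairing_Fubini g e A nu : 0 < g -> measurable_fun setT e ->
  finite_moments nu ->
  leb.-integrable setT (fun x : R => (e x * Poisson g x)%:E) ->
  (\int[leb]_x `|e x * Poisson g x|%:E <= A%:E)%E ->
  fine (\int[leb]_x (e x * Pconv g nu x)%:E)%E = \int[nu]_t Poisson_pairing g e t.
Proof.
move=> g0 me hnu ie eA; rewrite /Rintegral; congr fine.
transitivity (\int[leb]_x \int[nu]_t (e x * Poisson g (x - t))%:E)%E.
  apply: eq_integral => x _; rewrite /Pconv -[fine _]/(Rintegral _ _ _).
  rewrite -RintegralZl//; last exact: integrable_Poisson.
  rewrite /Rintegral fineK//; apply: integrable_fin_num => //.
  under eq_fun do rewrite EFinM; apply: integrableZl => //.
  exact: integrable_Poisson.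
rewrite (Fubini (Poisson_pairing_integrable_prod g e A nu g0 me hnu eA)).
apply: eq_integral => t _; rewrite /Poisson_pairing /Rintegral fineK//.
by apply: integrable_fin_num => //; exact: integrable_Poisson_pairing.
Qed.
End Pairing.

(** * Constants on bounded sets, and the conclusion *)

Section UniformBounds.
Context {R : realType}.

(** Shows that [BM M] is inhabited; the supremum over an empty set would be -oo. *)
Lemma dirac0_BM (M : R) : 0 < M -> BM M (\d_(0 : R) : probability R R).
Proof.
move=> M0 x /= x0; rewrite in_itv/= -ler_norml leNgt; apply/negP => Mx.
have := x0 `|x| (lt_trans M0 Mx).
rewrite [X in (0 < X)%E](_ : _ = 0%E) ?ltxx//.
rewrite -[LHS]/(\d_(0 : R) (ball x `|x|)) diracE memNset// /ball/= subr0.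
by rewrite ltxx.
Qed.

(** With u = |t - s| and k = 1 / g, the left side is k u (1 + k u), and u <= 2 K in the last
    factor. *)
Lemma Harnack_lipschitz (g K s t : R) : 0 < g -> `|s| <= K -> `|t| <= K ->
  Harnack g (t - s) - 1 <= g^-1 * (1 + 2 * K / g) * `|t - s|.
Proof.
move=> g0 sK tK; rewrite /Harnack.
have : `|t - s| <= 2 * K.
  by rewrite (le_trans (ler_normB _ _))//; lra.
have gi0 : 0 <= g^-1 by rewrite invr_ge0 ltW.
have := normr_ge0 (t - s); move: `|t - s| => u u0 uK; move: g^-1 gi0 => k k0.
have -> : 1 + u * k + (u * k) ^+ 2 - 1 = k * u * (1 + u * k) by ring.
have -> : k * (1 + 2 * K * k) * u = k * u * (1 + 2 * K * k) by ring.
by rewrite ler_wpM2l ?mulr_ge0// lerD2l ler_wpM2r.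
Qed.

Lemma Harnack_le (g K s : R) : 0 < g -> `|s| <= K -> Harnack g s <= Harnack g K.
Proof.
move=> g0 sK; have K0 : 0 <= K by exact: le_trans sK.
have gi0 : 0 <= g^-1 by rewrite invr_ge0 ltW.
have h : `|s| / g <= `|K| / g by rewrite ler_wpM2r// (ger0_norm K0).
by rewrite lerD ?lerD2l// lerXn2r// nnegrE mulr_ge0.
Qed.
End UniformBounds.

Theorem mainTheorem7 (R : realType)
    (nu nub : nat -> probability R R)
    (hnu : forall d, finite_moments (nu d))
    (hnub : forall d, compactly_supported (nub d))
    (hmom : forall k : nat,
        (fun d => `| moment (nu d) k - moment (nub d) k |) @ \oo --> (0 : R))
    (hsupp : exists2 M' : R, 0 < M' & forall d, msupport (nub d) `<=` `[- M', M'])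
    : forall g M : R, 0 < g -> 0 < M ->
      (fun d => ereal_sup
         [set (`| Hg g (nu d) mu - Hg g (nub d) mu |)%:E | mu in BM M])
        @ \oo --> (0 : \bar R)%E.
Proof.
move=> g M g0 M0; have [M' M'0 nubM] := hsupp.
have hnub' d : finite_moments (nub d) by exact: msupport_finite_moments (nubM d).
have [A A0 HA] := ell_Poisson_integrable g M g0 M0.
have [B B0 HB] := Harnack_le_quadratic g g0.
pose phi mu := Poisson_pairing g (fun x => ell g x mu).
(* The Lipschitz constant of every phi_mu on [-(M' + 1), M' + 1]: the constant of
   [Harnack_lipschitz] times the largest value of [Harnack g s * A] there. *)
pose L := g^-1 * (1 + 2 * (M' + 1) / g) * (Harnack g (M' + 1) * A).
have gi0 : 0 <= g^-1 by rewrite invr_ge0 ltW.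
have HA0 : 0 <= Harnack g (M' + 1) * A by rewrite mulr_ge0// ltW// Harnack_gt0.
have L0 : 0 <= L.
  have K2 : 0 <= 2 * (M' + 1) by lra.
  by rewrite /L mulr_ge0// mulr_ge0// addr_ge0// divr_ge0// ltW.
have HgE mu d : BM M mu -> Hg g (nu d) mu = \int[nu d]_t phi mu t /\
    Hg g (nub d) mu = \int[nub d]_t phi mu t.
  move=> /HA[ie eA]; have me := measurable_ell g mu g0.
  by split; exact: (Poisson_pairing_Fubini g _ A).
have key eps : 0 < eps -> \forall d \near \oo, forall mu, BM M mu ->
    `|Hg g (nu d) mu - Hg g (nub d) mu| <= eps.
  move=> eps0.
  have H := @uniform_merge R nu nub M' L (B * A) [set phi mu | mu in BM M]
    M'0 L0 (mulr_ge0 B0 A0) hmom hnu nubM.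
  apply: filterS (H _ eps eps0) => [d Hd mu muM|_ [mu muM <-]].
    have [-> ->] := HgE mu d muM.
    by apply: Hd; exists mu.
  have [ie eA] := HA mu muM; have me := measurable_ell g mu g0.
  split.
  (* Measurability of phi_mu does not involve the sequence, so any of its terms can supply the
     finite measure for Fubini. *)
  - exact: measurable_Poisson_pairing (hnu 0%N) eA.
  - move=> s t sK tK.
    apply: le_trans (Poisson_pairing_dist g _ A s t g0 me ie eA) _.
    rewrite /L mulrAC ler_pM//.
    + by rewrite subr_ge0 Harnack_ge1.
    + by rewrite mulr_ge0// ltW// Harnack_gt0.
    + exact: Harnack_lipschitz.
    + by rewrite ler_wpM2r// Harnack_le.
  - move=> t; apply: le_trans (Poisson_pairing_le g _ A t g0 me ie eA) _.
    by rewrite mulrAC ler_wpM2r.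
have ge0 d : (0 <= ereal_sup
    [set (`| Hg g (nu d) mu - Hg g (nub d) mu |)%:E | mu in BM M])%E.
  apply: (@le_trans _ _ (`| Hg g (nu d) (\d_(0 : R) : probability R R)
     - Hg g (nub d) (\d_(0 : R) : probability R R)|)%:E).
    by rewrite lee_fin.
  apply: ereal_sup_ubound; exists (\d_(0 : R) : probability R R) => //.
  exact: dirac0_BM.
have le_eps eps : 0 < eps -> \forall d \near \oo, (ereal_sup
    [set (`| Hg g (nu d) mu - Hg g (nub d) mu |)%:E | mu in BM M] <= eps%:E)%E.
  move=> /key; apply: filterS => d Hd.
  by apply: ge_ereal_sup => _ [mu muM <-]; rewrite lee_fin Hd.
(* Convergence in the extended reals: the suprema are eventually finite, by the bound at eps = 1,
   and then their real values tend to 0. *)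
apply/fine_cvgP; split.
  apply: filterS (le_eps 1 ltr01) => d d1.
  by rewrite ge0_fin_numE// (le_lt_trans d1)// ltry.
apply/cvgr0Pnorm_le => eps eps0.
apply: filterS (le_eps eps eps0) => d deps /=.
rewrite ger0_norm ?fine_ge0// -lee_fin fineK//.
by rewrite ge0_fin_numE// (le_lt_trans deps)// ltry.
Qed.
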